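(* Let $V$ be a finite set of size $n$, let $k$ be an integer with $0\le 2k\le n$, and let $t\in\{1,\ldots,k-1\}$. Let $I,J\subseteq V$ be disjoint of size $i=\#I$ and $j=\#J$, and suppose that the paired function $p_{I,J}:\binom{V}{k}\to\mathbb{R}$ has degree $t$. Then $p_{I,J}$ is smaller than a $t$-pencil (i.e. $\#p_{I,J}<\binom{n-t}{k-t}$) precisely in the following cases: (i) $t$ is even and $n=2k$ and $\{i,j\}=\{t+1,0\}$, where $\#p_{I,J}=2\binom{2k-t-1}{k}$. If additionally $k=t+1$ (where $\#p_{I,J}=2$), then there are the alternative representations $\{i,j\}=\{t+1,\ell\}$ with $\ell\in\{0,\ldots,t+1\}$ (which also belong to this case). (ii) $t$ is even and $n=2k$ and $k=t+1$ and $i,j\in\{1,\ldots,k-1\}$ with $i+j>k$ and $\binom{2k-i-j}{k-i}<\frac{k+1}{2}$, where $\#p_{I,J}=2\binom{2k-i-j}{k-i}$. Moreover, $p_{I,J}$ has the same size as a $t$-pencil (i.e. $\#p_{I,J}=\binom{n-t}{k-t}$) precisely in the following cases: (iii) $t$ is even and $t\le k$ and $n=2k+1$ and $\{i,j\}=\{t+1,0\}$. (iv) $t$ is even and $n=2k$ and $k=t+1$ and $i,j\in\{1,\ldots,k-1\}$ with $i+j\ge k$ and $\binom{2k-i-j}{k-i}=\frac{k+1}{2}$.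
   Context: $\binom{V}{k}$ is the set of all $k$-element subsets of $V$; $A^\complement=V\setminus A$. For $A\subseteq B\subseteq V$, the basic function $f_{A,B}:\binom{V}{k}\to\mathbb{R}$ is the characteristic function of $\{K\in\binom{V}{k}\mid A\subseteq K\subseteq B\}$. For disjoint $I,J\subseteq V$, the paired function is $p_{I,J}=f_{I,J^\complement}+f_{J,I^\complement}$. For $T\subseteq V$ with $\#T=t$, the function $f_{T,V}$ is called a $t$-pencil. The size of $f:\binom{V}{k}\to\mathbb{R}$ is $\#f=\sum_{K\in\binom{V}{k}}f(K)$; a $t$-pencil has size $\binom{n-t}{k-t}$. The degree of a non-zero function $f:\binom{V}{k}\to\mathbb{R}$ is the smallest $t$ such that $f$ is an $\mathbb{R}$-linear combination of $t$-pencils; the degree of the zero function is $-\infty$. *)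

(* Defs.v *)
From HB Require Import structures.
From mathcomp Require Import all_boot all_order all_algebra.
From mathcomp Require Import reals.

Set Implicit Arguments.
Unset Strict Implicit.
Unset Printing Implicit Defensive.

Import Order.TTheory GRing.Theory Num.Theory.
Local Open Scope ring_scope.

Definition ksubset (V : finType) (k : nat) : finType :=
  {K : {set V} | #|K| == k}.

Definition kfun (R : realType) (V : finType) (k : nat) : lmodType R :=
  {ffun ksubset V k -> R^o}.

Section Functions.

Variables (R : realType) (V : finType) (k : nat).
Implicit Types (A B I J T : {set V}) (f : kfun R V k).

Definition basic A B : kfun R V k :=
  [ffun K : ksubset V k =>
     ((A \subset val K) && (val K \subset B))%:R : R^o].

Definition paired I J : kfun R V k := basic I (~: J) + basic J (~: I).

Definition pencil T : kfun R V k := basic T [set: V].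

Definition fsize f : R := \sum_(K : ksubset V k) f K.

Definition pencil_comb (t : nat) f : Prop :=
  exists c : {set V} -> R, f = \sum_(T : {set V} | #|T| == t) c T *: pencil T.

(* The zero function has degree -oo, hence no natural number as its degree. *)
Definition has_degree f (t : nat) : Prop :=
  [/\ f != 0, pencil_comb t f & forall s : nat, pencil_comb s f -> (t <= s)%N].

End Functions.

Arguments basic R {V} k A B.
Arguments paired R {V} k I J.
Arguments pencil R {V} k T.

(* Equality {i, j} = {a, b} of unordered pairs. *)
Definition same_pair (i j a b : nat) : Prop :=
  (i = a /\ j = b) \/ (i = b /\ j = a).

Definition case_i (n k t i j : nat) : Prop :=
  [/\ ~~ odd t, n = (2 * k)%N &
      same_pair i j t.+1 0 \/
      (k = t.+1 /\ exists2 l : nat, (l <= t.+1)%N & same_pair i j t.+1 l)].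

(* As i, j < k, no subtraction below is truncated (likewise in case_iv). *)
Definition case_ii (n k t i j : nat) : Prop :=
  [/\ ~~ odd t, n = (2 * k)%N, k = t.+1,
      (1 <= i <= k - 1)%N && (1 <= j <= k - 1)%N &
      (k < i + j)%N /\
      ('C(2 * k - i - j, k - i)%:R < k.+1%:R / 2 :> rat)].

Definition case_iii (n k t i j : nat) : Prop :=
  [/\ ~~ odd t, (t <= k)%N, n = (2 * k).+1 & same_pair i j t.+1 0].

Definition case_iv (n k t i j : nat) : Prop :=
  [/\ ~~ odd t, n = (2 * k)%N, k = t.+1,
      (1 <= i <= k - 1)%N && (1 <= j <= k - 1)%N &
      (k <= i + j)%N /\
      ('C(2 * k - i - j, k - i)%:R = k.+1%:R / 2 :> rat)].

(* Main.v *)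
(* Given m disjoint pairs (a_s, b_s) with all a_s in a k-set K0 and all b_s
   outside it, the signed sum of a function over the 2^m sets obtained from K0 by
   exchanging some of the a_s for b_s vanishes on every pencil of a set with
   fewer than m elements.  Choosing the pairs so that every a_s is in I or b_s is
   in J, at most two terms of the sum survive on p_{I,J}.  If p_{I,J} has degree
   t < k, this forces i + j <= t, or i + j = t + 1 <= k with t even, or
   i + j > k, n = 2k and t = k - 1 even.  In each of these regimes the size
   C(n-i-j, k-i) + C(n-i-j, k-j) is compared with C(n-t, k-t) by means of
   Pascal's rule and the unimodality of the binomial coefficients. *)

Require Import Defs.
From HB Require Import structures.
From mathcomp Require Import all_boot all_order all_algebra.
From mathcomp Require Import reals zify.

Set Implicit Arguments.
Unset Strict Implicit.
Unset Printing Implicit Defensive.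

Import Order.TTheory GRing.Theory Num.Theory.
Local Open Scope ring_scope.

(* Drops the membership and inclusion facts: lia would split on each of them. *)
Ltac card_lia :=
  repeat match goal with
  | H : is_true ?b |- _ =>
      lazymatch b with
      | context [leq] => fail
      | context [muln] => fail
      | _ => clear H
      end
  end; lia.

(** * Unimodality of binomial coefficients *)

Lemma ltn_binS (N c : nat) : (c.*2.+1 < N)%N -> ('C(N, c) < 'C(N, c.+1))%N.
Proof.
move=> h.
have C0 : (0 < 'C(N, c))%N by rewrite bin_gt0; lia.
have := mul_bin_left N c; nia.
Qed.

(** The symmetry [b -> N - b] moves [b] into the lower half, still above [a] because [a + b < N];
    there the coefficients increase step by step. *)
Lemma ltn_bin (N a b : nat) :
  (a < b)%N -> (a + b < N)%N -> ('C(N, a) < 'C(N, b))%N.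
Proof.
wlog hb : b / (b.*2 <= N)%N => [wl ab abN|].
  have [hb|hb] := leqP b.*2 N; first exact: wl.
  by rewrite -(@bin_sub N b); [apply: wl; lia|lia].
move=> ab _; elim: b hb ab => // b IHb hb; rewrite ltnS leq_eqVlt.
case/predU1P => [->|ab]; first by apply: ltn_binS; lia.
by apply: (ltn_trans (IHb _ ab)); [lia|apply: ltn_binS; lia].
Qed.

Lemma leq_bin (N a b : nat) :
  (a <= b)%N -> (a + b <= N)%N -> ('C(N, a) <= 'C(N, b))%N.
Proof.
move=> ab abN; have [->//|anb] := eqVneq a b.
have [<-|ne] := eqVneq (a + b)%N N; last by apply/ltnW/ltn_bin; lia.
by rewrite -[in leqRHS](@bin_sub _ b) ?leq_addl // addnK.
Qed.

(** * Existence and number of sets between two given sets *)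

Lemma set_between (T : finType) (A C : {set T}) (m : nat) :
  A \subset C -> (#|A| <= m <= #|C|)%N ->
  exists B : {set T}, [/\ A \subset B, B \subset C & #|B| = m].
Proof.
move=> AC /andP[Am mC].
have : (0 < #|[set D : {set T} | D \subset C :\: A & #|D| == m - #|A|]|)%N.
  by rewrite cards_draws bin_gt0 cardsDS //; lia.
case/card_gt0P => D; rewrite inE => /andP[DCA /eqP Dm].
exists (A :|: D); split; first exact: subsetUl.
  by rewrite subUset AC (subset_trans DCA) ?subsetDl.
have AD0 : A :&: D = set0.
  apply/setP => x; rewrite !inE; case: (boolP (x \in D)) => [xD|]; last by rewrite andbF.
  by have := subsetP DCA _ xD; rewrite inE => /andP[/negPf->].
by rewrite cardsU AD0 cards0 Dm; lia.
Qed.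

Lemma card_interval (T : finType) (A B : {set T}) (k : nat) :
  A \subset B -> (#|A| <= k)%N ->
  #|[set K : {set T} | (A \subset K) && (K \subset B) & #|K| == k]| =
  'C(#|B| - #|A|, k - #|A|).
Proof.
move=> AB Ak; rewrite -cardsDS // -cards_draws.
rewrite -(@card_in_imset _ _ (fun K => K :\: A)) => [|K L]; last first.
  rewrite !inE => /andP[/andP[AK _] _] /andP[/andP[AL _] _] /(congr1 (setU A)).
  by rewrite !setDE !setUIr !setUCr !setIT => e; rewrite -(setUidPr AK) e (setUidPr AL).
apply: eq_card => D; rewrite inE; apply/imsetP/andP.
  case=> K; rewrite inE => /andP[/andP[AK KB] /eqP <-] ->.
  by rewrite setSD ?cardsDS.
case=> DBA /eqP Dk.
have AD0 : D :&: A = set0.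
  apply/setP => x; rewrite !inE; case: (boolP (x \in D)) => // xD.
  by have := subsetP DBA _ xD; rewrite inE => /andP[/negPf->].
exists (A :|: D); last first.
  by rewrite setDUl setDv set0U setDE; apply/esym/setIidPl; rewrite -disjoints_subset -setI_eq0 AD0.
rewrite inE subsetUl subUset AB (subset_trans DBA) ?subsetDl //=.
by rewrite cardsU setIC AD0 cards0 Dk; apply/eqP; lia.
Qed.

(** * Alternating sums over exchanges of pairs *)

Section AlternatingSums.

Variables (V : finType) (m : nat) (a b : 'I_m -> V) (K0 : {set V}).
Hypotheses (inj_a : injective a) (inj_b : injective b).
Hypotheses (aK0 : forall s, a s \in K0) (bK0 : forall s, b s \notin K0).

Definition switch (S : {set 'I_m}) : {set V} := (K0 :\: a @: S) :|: b @: S.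

Lemma mem_switch_a S s : (a s \in switch S) = (s \notin S).
Proof.
rewrite !inE aK0 andbT (mem_imset _ _ inj_a).
suff /negPf-> : a s \notin b @: S by rewrite orbF.
by apply: contraL (aK0 s) => /imsetP[r _ ->].
Qed.

Lemma mem_switch_b S s : (b s \in switch S) = (s \in S).
Proof. by rewrite !inE (negPf (bK0 s)) andbF (mem_imset _ _ inj_b). Qed.

Lemma card_switch S : #|switch S| = #|K0|.
Proof.
have aS : a @: S \subset K0 by apply/subsetP => _ /imsetP[s _ ->].
have d : (K0 :\: a @: S) :&: b @: S = set0.
  apply/setP => x; rewrite !inE; apply/negP => /andP[/andP[_ xK]] /imsetP[s _ e].
  by move: (bK0 s); rewrite -e xK.
have := subset_leq_card aS.
rewrite cardsU d cards0 cardsDS // !card_imset // subn0 => h.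
by rewrite subnK.
Qed.

Lemma switch_off S s x :
  x != a s -> x != b s -> (x \in switch (S :\ s)) = (x \in switch S).
Proof.
have im (f : 'I_m -> V) : x != f s -> (x \in f @: (S :\ s)) = (x \in f @: S).
  move=> xs; apply/imsetP/imsetP => -[r]; first by rewrite inE => /andP[_ rS] ->; exists r.
  by move=> rS xr; exists r => //; rewrite !inE rS andbT; apply: contraNneq xs => <-; rewrite xr.
by move=> xa xb; rewrite !inE !im.
Qed.

(** If every pair met [T], choosing a point of [T] in each would be injective, since [K0] separates
    the [a s] from the [b s]; [T] would then have at least [m] elements. *)
Lemma untouched_pair (T : {set V}) :
  (#|T| < m)%N -> exists s, (a s \notin T) && (b s \notin T).
Proof.
move=> Tm; apply/existsP; apply: contraLR Tm; rewrite negb_exists -leqNgt.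
move=> /forallP touched; pose h s := if a s \in T then a s else b s.
have inj_h : injective h.
  move=> s r; rewrite /h; case: ifP => _; case: ifP => _.
  - exact: inj_a.
  - by move=> e; move: (bK0 r); rewrite -e aK0.
  - by move=> e; move: (bK0 s); rewrite e aK0.
  - exact: inj_b.
rewrite -[m]card_ord -cardsT -(card_imset _ inj_h); apply: subset_leq_card.
apply/subsetP => _ /imsetP[s _ ->]; rewrite /h; case: ifP => // aT.
by have := touched s; rewrite aT /= negbK.
Qed.

(* Toggling a pair disjoint from T flips the sign and keeps T \subset _. *)
Lemma alternating_pencil (R : realType) (T : {set V}) : (#|T| < m)%N ->
  \sum_(S : {set 'I_m}) (-1) ^+ #|S| * (T \subset switch S)%:R = 0 :> R.
Proof.
case/untouched_pair => s /andP[aT bT].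
pose flip (S : {set 'I_m}) := [set r | (r \in S) (+) (r == s)].
have flipK : involutive flip.
  by move=> S; apply/setP => r; rewrite !inE -addbA addbb addbF.
have flipD S : flip S :\ s = S :\ s.
  by apply/setP => r; rewrite !inE; case: eqP => //=; rewrite addbF.
have subD S : (T \subset switch (S :\ s)) = (T \subset switch S).
  apply/subsetP/subsetP => h x xT; have := h x xT; rewrite switch_off //.
  - by apply: contraNneq aT => <-.
  - by apply: contraNneq bT => <-.
  - by apply: contraNneq aT => <-.
  - by apply: contraNneq bT => <-.
set L := \sum_S _.
suff /eqP : L = - L by rewrite -subr_eq0 opprK -mulr2n mulrn_eq0 /= => /eqP.
rewrite {1}/L (reindex_inj (inv_inj flipK)) /= /L -sumrN; apply: eq_bigr => S _.
rewrite -(subD (flip S)) flipD subD -mulNr; congr (_ * _).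
rewrite (cardsD1 s (flip S)) flipD (cardsD1 s S) !exprD inE eqxx addbT.
by case: (s \in S); rewrite /= ?expr1 ?expr0 ?mulN1r ?mul1r ?opprK.
Qed.

Lemma switch0 : switch set0 = K0.
Proof. by rewrite /switch !imset0 setD0 setU0. Qed.

Variables (I J : {set V}).
Hypotheses (IK0 : I \subset K0) (JK0 : [disjoint J & K0]).
Hypothesis (covered : forall s, (a s \in I) || (b s \in J)).

(** Each exchange loses a point of [I] or gains a point of [J], so only the unchanged set [K0]
    survives. *)
Lemma switch_basic S :
  (I \subset switch S) && (switch S \subset ~: J) = (S == set0).
Proof.
apply/andP/eqP => [[Isub subJ]|->]; last first.
  by rewrite switch0 IK0 subsets_disjoint setCK disjoint_sym.
apply/setP => s; rewrite inE; apply/negP => sS; case/orP: (covered s) => [aI|bJ].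
  by have := subsetP Isub _ aI; rewrite mem_switch_a sS.
by have := subsetP subJ (b s); rewrite mem_switch_b inE bJ => /(_ sS).
Qed.

(** A pair left in place keeps a point of [I] or misses a point of [J], so all pairs must be
    exchanged; this suffices exactly when the [a s] exhaust [I] and the [b s] exhaust [J]. *)
Lemma switch_basicC S :
  (J \subset switch S) && (switch S \subset ~: I) =
  [&& S == setT, I \subset a @: setT & J \subset b @: setT].
Proof.
have eqT : (J \subset switch S) && (switch S \subset ~: I) -> S = setT.
  case/andP => Jsub subI; apply/setP => s; rewrite inE; apply/idPn => sS.
  case/orP: (covered s) => [aI|bJ].
    by have := subsetP subI (a s); rewrite mem_switch_a inE aI => /(_ sS).
  by have := subsetP Jsub _ bJ; rewrite mem_switch_b (negPf sS).
have [->|nT] := eqVneq S setT; last by apply/negbTE; apply: contraNN nT => /eqT->.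
rewrite /= andbC; congr (_ && _).
  apply/subsetP/subsetP => h x xI.
    have := h x; rewrite !inE xI (subsetP IK0) // andbT.
    by case: (x \in a @: _) => //= /(_ isT).
  rewrite inE; apply: contraL xI => xI; rewrite !inE (h _ xI) /=.
  by apply/imsetP => -[s _ e]; move: (subsetP IK0 _ xI) (bK0 s); rewrite e => ->.
apply/subsetP/subsetP => h x xJ; have := h x xJ; rewrite !inE.
  by rewrite (disjointFr JK0 xJ) andbF.
by move->; rewrite orbT.
Qed.

(** [K_] equips each [switch S] with its cardinality proof so that [f] can be evaluated there; the
    rest is linearity. *)
Lemma alternating_pencil_comb (R : realType) (k t : nat) (f : kfun R V k)
    (K_ : {set 'I_m} -> ksubset V k) :
    (forall S, val (K_ S) = switch S) -> (t < m)%N -> pencil_comb t f ->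
  \sum_(S : {set 'I_m}) (-1) ^+ #|S| * f (K_ S) = 0.
Proof.
move=> K_E tm [c ->].
under eq_bigr => S _ do rewrite sum_ffunE mulr_sumr.
rewrite exchange_big big1 //= => T /eqP Tt.
transitivity (c T * \sum_(S : {set 'I_m}) (-1) ^+ #|S| * (T \subset switch S)%:R).
  rewrite mulr_sumr; apply: eq_bigr => S _; rewrite !ffunE K_E subsetT andbT /=.
  by rewrite mulrCA.
by rewrite alternating_pencil ?Tt ?mulr0.
Qed.

(** The 1 comes from [S = set0] in [basic I (~: J)], the signed term from [S = setT] in
    [basic J (~: I)]. *)
Lemma alternating_paired (R : realType) (k : nat)
    (K_ : {set 'I_m} -> ksubset V k) :
    (forall S, val (K_ S) = switch S) ->
  \sum_(S : {set 'I_m}) (-1) ^+ #|S| * paired R k I J (K_ S) =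
  1 + (-1) ^+ m * ((I \subset a @: setT) && (J \subset b @: setT))%:R.
Proof.
move=> K_E.
under eq_bigr => S _ do
  rewrite !ffunE K_E switch_basic switch_basicC mulrDr.
rewrite big_split /=; congr (_ + _).
  rewrite (bigD1 set0) //= cards0 eqxx mulr1 big1 ?addr0 // => S /negPf->.
  by rewrite mulr0.
rewrite (bigD1 setT) //= cardsT card_ord eqxx big1 ?addr0 // => S /negPf->.
by rewrite mulr0.
Qed.

End AlternatingSums.

(** * Restrictions on paired functions of low degree *)

(* A is paired with elements of C so that A \ I goes into J; the alternating sum
   of p_{I,J} is then 1, or 1 + (-1)^#|A| if I is in A and J is in its image. *)
Lemma low_degree_paired (R : realType) (V : finType) (k t : nat)
    (I J K0 A C : {set V}) :
    pencil_comb t (paired R k I J) ->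
    #|K0| = k -> I \subset K0 -> [disjoint J & K0] ->
    A \subset K0 -> [disjoint C & K0] -> (t < #|A| <= #|C|)%N ->
    (#|A :\: I| <= #|C :&: J|)%N ->
  [/\ odd #|A|, I \subset A & J \subset C].
Proof.
move=> pt K0k IK0 JK0 AK0 CK0 /andP[tA AC] AIJ.
(* The order matters: [A :\: I] and [C :&: J] come first, and the former is no larger, so each point
   of [A] outside [I] gets a partner in [J]. *)
pose As := enum (A :\: I) ++ enum (A :&: I).
pose Cs := enum (C :&: J) ++ enum (C :\: J).
have As_size : size As = #|A| by rewrite size_cat -!cardE addnC cardsID.
have Cs_size : size Cs = #|C| by rewrite size_cat -!cardE cardsID.
have memA x : (x \in As) = (x \in A).
  by rewrite mem_cat !mem_enum !inE; case: (x \in I); case: (x \in A).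
have memC x : (x \in Cs) = (x \in C).
  by rewrite mem_cat !mem_enum !inE; case: (x \in J); case: (x \in C).
have uA : uniq As.
  rewrite cat_uniq !enum_uniq andbT /=; apply/hasPn => x.
  by rewrite !mem_enum !inE => /andP[_ ->].
have uC : uniq Cs.
  rewrite cat_uniq !enum_uniq andbT /=; apply/hasPn => x.
  by rewrite !mem_enum !inE => /andP[/negPf-> _]; rewrite andbF.
have [x0 _] : exists x, x \in A by apply/card_gt0P; card_lia.
pose a (s : 'I_#|A|) := nth x0 As s; pose b (s : 'I_#|A|) := nth x0 Cs s.
have sA (s : 'I_#|A|) : (s < size As)%N by rewrite As_size.
have sC (s : 'I_#|A|) : (s < size Cs)%N by rewrite Cs_size (leq_trans (ltn_ord s)).
have inj_a : injective a by move=> s r /eqP; rewrite nth_uniq // => /eqP/val_inj.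
have inj_b : injective b by move=> s r /eqP; rewrite nth_uniq // => /eqP/val_inj.
have aA s : a s \in A by rewrite -memA mem_nth.
have bC s : b s \in C by rewrite -memC mem_nth.
have aK0 s : a s \in K0 by exact: (subsetP AK0).
have bK0 s : b s \notin K0 by rewrite (disjointFr CK0).
have covered s : (a s \in I) || (b s \in J).
  have [lt|ge] := ltnP s #|A :\: I|.
    suff : b s \in C :&: J by rewrite inE => /andP[_ ->]; rewrite orbT.
    have lt' := leq_trans lt AIJ.
    by rewrite /b nth_cat -cardE lt' -mem_enum mem_nth // -cardE.
  suff : a s \in A :&: I by rewrite inE => /andP[_ ->].
  rewrite /a nth_cat -cardE ltnNge ge /= -mem_enum mem_nth //.
  by rewrite -cardE ltn_subLR // addnC cardsID.
have card_sw S : #|switch a b K0 S| == k by rewrite card_switch // K0k.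
pose K_ S : ksubset V k := Sub (switch a b K0 S) (card_sw S).
have K_E S : val (K_ S) = switch a b K0 S by [].
have := alternating_pencil_comb inj_a inj_b aK0 bK0 K_E tA pt.
rewrite (alternating_paired inj_a inj_b aK0 bK0 IK0 JK0 covered R K_E).
(* The sum vanishes, so it is not 1: the signed term is present and equals -1, which makes [#|A|]
   odd. *)
case: andP => [[Ia Jb]|_] /eqP; last by rewrite mulr0 addr0 oner_eq0.
rewrite mulr1 -signr_odd => h; split.
- by move: h; case: odd => //; rewrite -mulr2n pnatr_eq0.
- by apply: subset_trans Ia _; apply/subsetP => _ /imsetP[s _ ->].
- by apply: subset_trans Jb _; apply/subsetP => _ /imsetP[s _ ->].
Qed.

Lemma paired_sym (R : realType) (V : finType) (k : nat) (I J : {set V}) :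
  paired R k I J = paired R k J I.
Proof. by rewrite /paired addrC. Qed.

Lemma basic_eq0 (R : realType) (V : finType) (k : nat) (A B : {set V}) :
  (k < #|A|)%N || (#|B| < k)%N -> basic R k A B = 0.
Proof.
move=> h; apply/ffunP => K; rewrite !ffunE.
case: andP => // -[/subset_leq_card AK /subset_leq_card KB].
by move: AK KB h; rewrite (eqP (valP K)); card_lia.
Qed.

(** Applied to a large enough [A] or [C] that omits a point of [I] or [J], [low_degree_paired] is
    contradicted; this bounds the cardinalities, and its parity clause makes [t] even. *)
Lemma pencil_comb_paired (R : realType) (V : finType) (k t : nat)
    (I J : {set V}) :
    [disjoint I & J] -> (2 * k <= #|V|)%N -> (t < k)%N ->
    paired R k I J != 0 -> pencil_comb t (paired R k I J) ->
  [\/ (#|I| + #|J| <= t)%N,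
      [/\ (#|I| + #|J|)%N = t.+1, (#|I| + #|J| <= k)%N & ~~ odd t] |
      [/\ (k < #|I| + #|J|)%N, (#|I| <= k)%N, (#|J| <= k)%N,
          #|V| = (2 * k)%N & k = t.+1 /\ ~~ odd t]].
Proof.
move=> dIJ hk tk p0 pt.
have [small|] := leqP (#|I| + #|J|) t; first by constructor 1.
(* If neither order of [I] and [J] qualifies, both basic functions vanish, contrary to [p0]. *)
wlog [Ik Jnk I0] : I J dIJ p0 pt /
    [/\ #|I| <= k, #|J| <= #|V| - k & (0 < #|I|) || (k < #|I| + #|J|)]%N.
  move=> wl tIJ.
  have [|nIJ] := boolP
      [&& #|I| <= k, #|J| <= #|V| - k & (0 < #|I|) || (k < #|I| + #|J|)]%N.
    by case/and3P => Ik Jnk I0; apply: wl.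
  have [/and3P[Jk Ink J0]|nJI] := boolP
      [&& #|J| <= k, #|I| <= #|V| - k & (0 < #|J|) || (k < #|J| + #|I|)]%N.
    have := wl J I; rewrite disjoint_sym paired_sym [(#|J| + _)%N]addnC.
    move/(_ dIJ p0 pt); rewrite addnC in J0; move/(_ (And3 Jk Ink J0) tIJ).
    by case=> [?|[? ? ?]|[? ? ? ? ?]]; [constructor 1|constructor 2|constructor 3].
  have := cardsC I; have := cardsC J => cJ cI.
  by case/eqP: p0; rewrite /paired !basic_eq0 ?addr0 //; card_lia.
move: I0 => + tIJ.
have IJC : I \subset ~: J by rewrite -disjoints_subset.
have [|K0 [IK0 K0J K0k]] := @set_between _ I (~: J) k IJC.
  by have := cardsC J; card_lia.
have JK0 : [disjoint J & K0] by rewrite disjoint_sym disjoints_subset.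
have JK0C : J \subset ~: K0 by rewrite -disjoints_subset.
have CK0 : [disjoint ~: K0 & K0] by rewrite disjoints_subset.
have cK0 : #|~: K0| = (#|V| - k)%N by have := cardsC K0; card_lia.
have CJ : #|~: K0 :&: J| = #|J| by rewrite (setIidPr JK0C).
have drop_elt (A : {set V}) w : w \in I -> I \subset A -> A \subset K0 -> (t < #|A :\ w|)%N ->
    (#|A| <= #|I| + #|J|)%N -> False.
  move=> wI IA AK0 tA AIJ.
  have [||_] := low_degree_paired pt K0k IK0 JK0 (subset_trans (subD1set A w) AK0) CK0.
  - by rewrite tA cK0; have := subset_leq_card (subset_trans (subD1set A w) AK0); card_lia.
  - rewrite CJ (_ : (A :\ w) :\: I = A :\: I) ?cardsDS ?leq_subLR //.
    apply/setP => x; rewrite !inE; case: eqP => [->|//]; by rewrite wI.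
  by move=> /subsetP/(_ w wI); rewrite !inE eqxx.
have [large|le_k] := ltnP k (#|I| + #|J|); last first.
  (* With [#|I| + #|J|] elements, [A] has exactly [#|J|] points outside [I]. This size must be odd,
     and deleting a point of [I] bounds it by [t + 1]. *)
  rewrite orbF => I0; have [|A [IA AK0 Am]] := @set_between _ I K0 (#|I| + #|J|) IK0.
    by rewrite K0k leq_addr.
  have [||odd_s _ _] := low_degree_paired pt K0k IK0 JK0 AK0 CK0.
  - by rewrite Am cK0; card_lia.
  - by rewrite CJ cardsDS // Am; card_lia.
  have [w wI] : exists w, w \in I by apply/card_gt0P; card_lia.
  have [tA|] := ltnP t #|A :\ w|; first by case: (drop_elt A w); rewrite ?Am.
  move: odd_s; rewrite Am => odd_s.
  have := cardsD1 w A; rewrite (subsetP IA) // Am => cA tA.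
  have e : (#|I| + #|J|)%N = t.+1 by card_lia.
  by constructor 2; split => //; move: odd_s; rewrite e.
move=> _; have [n2k|n2k] := eqVneq #|V| (2 * k)%N; last first.
  (* For [#|V| > 2k] the complement of [K0] has a point to spare: without [y] it still offers [k]
     partners, of which [#|J| - 1 >= k - #|I|] lie in [J]. *)
  have [y yJ] : exists y, y \in J by apply/card_gt0P; card_lia.
  have [|||_ _ /subsetP/(_ y yJ)] := @low_degree_paired R V k t I J K0 K0
    (~: K0 :\ y) pt K0k IK0 JK0 (subxx _); last by rewrite !inE eqxx.
  - by apply: disjointWl CK0; exact: subD1set.
  - have := cardsD1 y (~: K0); rewrite (subsetP JK0C) // cK0 K0k; card_lia.
  - suff -> : (~: K0 :\ y) :&: J = J :\ y.
      by rewrite cardsDS // K0k; have := cardsD1 y J; rewrite yJ; card_lia.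
    apply/setP => x; rewrite !inE; case: (boolP (x \in J)) => xJ; last by rewrite !andbF.
    by rewrite (disjointFr JK0 xJ) !andbT.
(* Taking all of [K0] as [A] makes [k] odd; deleting a point of [I] then forces [k = t + 1]. *)
have [||oddk _ _] := low_degree_paired pt K0k IK0 JK0 (subxx _) CK0.
- by rewrite K0k cK0; card_lia.
- by rewrite CJ cardsDS // K0k; card_lia.
have [w wI] : exists w, w \in I by apply/card_gt0P; card_lia.
have := cardsD1 w K0; rewrite (subsetP IK0) // K0k => cKw.
have [tA|tA] := ltnP t #|K0 :\ w|.
  by case: (drop_elt K0 w); rewrite ?K0k //; exact: ltnW.
have kt : k = t.+1 by card_lia.
constructor 3; split => //; first by move: Jnk; rewrite n2k; card_lia.
by split=> //; move: oddk; rewrite K0k kt.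
Qed.

(** * Sizes and coinciding representations of paired functions *)

Lemma fsizeD (R : realType) (V : finType) (k : nat) (f g : kfun R V k) :
  fsize (f + g) = fsize f + fsize g.
Proof. by rewrite /fsize -big_split; apply: eq_bigr => K _; rewrite ffunE. Qed.

Lemma fsize_basic (R : realType) (V : finType) (k : nat) (A B : {set V}) :
  A \subset B -> (#|A| <= k)%N ->
  fsize (basic R k A B) = 'C(#|B| - #|A|, k - #|A|)%:R.
Proof.
move=> AB Ak; rewrite -card_interval // /fsize.
under eq_bigr => K _ do rewrite ffunE.
rewrite -natr_sum -big_mkcond /= sum1_card -(card_imset _ val_inj); congr _%:R.
apply: eq_card => K; rewrite inE; apply/imsetP/andP => [[L LAB ->]|[KAB Kk]].
  by split; [exact: LAB|exact: (valP L)].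
by exists (Sub K Kk).
Qed.

(** Beyond the bounds by [k], a truncated [k - #|I|] would give the coefficient 1 for a basic
    function that is zero. *)
Lemma fsize_paired (R : realType) (V : finType) (k : nat) (I J : {set V}) :
    [disjoint I & J] -> (#|I| <= k)%N -> (#|J| <= k)%N ->
  fsize (paired R k I J) =
  ('C(#|V| - #|I| - #|J|, k - #|I|) + 'C(#|V| - #|I| - #|J|, k - #|J|))%:R.
Proof.
move=> dIJ Ik Jk; rewrite /paired fsizeD !fsize_basic -?disjoints_subset //.
  by rewrite [#|~: J|]cardsCs [#|~: I|]cardsCs !setCK natrD subnAC.
by rewrite disjoint_sym.
Qed.

Lemma basic_full (R : realType) (V : finType) (k : nat) (A B : {set V}) :
  #|A| = k -> A \subset B -> basic R k A B = basic R k A setT.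
Proof.
move=> Ak AB; apply/ffunP => K; rewrite !ffunE subsetT andbT.
case: (boolP (A \subset _)) => //= AK.
suff <- : A = val K by rewrite AB.
by apply/eqP; rewrite eqEcard AK Ak (eqP (valP K)) leqnn.
Qed.

Lemma basic_exact (R : realType) (V : finType) (k : nat) (A B : {set V}) :
  #|B| = k -> A \subset B -> basic R k A B = basic R k set0 B.
Proof.
move=> Bk AB; apply/ffunP => K; rewrite !ffunE sub0set /= andbC.
case: (boolP (_ \subset B)) => //= KB.
suff -> : val K = B by rewrite AB.
by apply/eqP; rewrite eqEcard KB Bk (eqP (valP K)) leqnn.
Qed.

(** [I] is the only [k]-set containing [I], and its complement, also of size [k], is the only
    [k]-set avoiding [I]; so neither summand depends on [J]. *)
Lemma paired_half (R : realType) (V : finType) (k : nat) (I J : {set V}) :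
    [disjoint I & J] -> #|V| = (2 * k)%N -> #|I| = k ->
  paired R k I J = paired R k I set0.
Proof.
move=> dIJ V2k Ik; rewrite /paired setC0 (@basic_full _ _ _ I) //; last first.
  by rewrite -disjoints_subset.
rewrite (@basic_exact _ _ _ J) // -?disjoints_subset 1?disjoint_sym //.
by have := cardsC I; lia.
Qed.

(** * Numerical comparison with the size of a pencil *)

Definition paired_size (n k i j : nat) : nat :=
  'C(n - i - j, k - i) + 'C(n - i - j, k - j).

Lemma paired_sizeC (n k i j : nat) : paired_size n k i j = paired_size n k j i.
Proof. by rewrite /paired_size addnC subnAC. Qed.

Lemma paired_size_half (k i j : nat) :
    (i <= k)%N -> (j <= k)%N ->
  paired_size (2 * k) k i j = (2 * 'C(2 * k - i - j, k - i))%N.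
Proof.
move=> ik jk; rewrite /paired_size [RHS]mul2n -addnn; congr addn.
by rewrite -bin_sub; [congr 'C(_, _)|]; lia.
Qed.

(** Pascal's rule brings the pencil size to the upper index [n - t.+1], that of [paired_size] when
    [i + j = t.+1]. *)
Lemma pencil_sizeS (n k t : nat) : (t < k)%N -> (k <= n)%N ->
  'C(n - t, k - t) = ('C(n - t.+1, k - t) + 'C(n - t.+1, k - t.+1))%N.
Proof.
move=> tk kn; rewrite (_ : (n - t)%N = (n - t.+1).+1); last by lia.
by rewrite (_ : (k - t)%N = (k - t.+1).+1) ?binS //; lia.
Qed.

(** The pencil size for [n = 2k] and [t = k - 1], source of the threshold [(k + 1) / 2] in [case_ii]
    and [case_iv]. *)
Lemma pencil_size_half (k : nat) : (0 < k)%N -> 'C(2 * k - k.-1, k - k.-1) = k.+1.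
Proof.
by move=> k0; rewrite (_ : (k - k.-1)%N = 1%N) ?bin1; lia.
Qed.

(** [C(n-t, k-t) = C(n-t, n-k)] is at most [C(n-i-j, n-k) = C(n-i-j, k-i-j)], which unimodality
    bounds by each of the two terms of [paired_size]. *)
Lemma paired_size_small (n k t i j : nat) :
    (2 * k <= n)%N -> (t < k)%N -> (i + j <= t)%N ->
  ('C(n - t, k - t) < paired_size n k i j)%N.
Proof.
move=> nk tk ijt; rewrite /paired_size.
have C0 : (0 < 'C(n - t, k - t))%N by rewrite bin_gt0; lia.
have le_t : ('C(n - t, k - t) <= 'C(n - i - j, k - i - j))%N.
  rewrite -(@bin_sub (n - t)) -1?(@bin_sub (n - i - j)); try lia.
  have -> : (n - t - (k - t) = n - k)%N by lia.
  have -> : (n - i - j - (k - i - j) = n - k)%N by lia.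
  by apply: leq_bin2l; lia.
have le_i : ('C(n - i - j, k - i - j) <= 'C(n - i - j, k - i))%N.
  by apply: leq_bin; lia.
have le_j : ('C(n - i - j, k - i - j) <= 'C(n - i - j, k - j))%N.
  by apply: leq_bin; lia.
lia.
Qed.

(** After Pascal's rule the terms compare one by one: lower index [k - t] against [k - i], and
    [k - i - j] against [k - j], the latter strictly. *)
Lemma paired_size_mixed (n k t i j : nat) :
    (2 * k <= n)%N -> (t < k)%N -> (i + j = t.+1)%N -> (0 < i)%N -> (0 < j)%N ->
  ('C(n - t, k - t) < paired_size n k i j)%N.
Proof.
move=> nk tk ijt i0 j0; rewrite /paired_size (@pencil_sizeS n k t) //; last by lia.
rewrite -ijt subnDA -addnS; apply: leq_add; first by apply: leq_bin; lia.
by apply: ltn_bin; lia.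
Qed.

(** Cancelling a common term leaves [C(n-t-1, k)] against [C(n-t-1, k-t)]. The lower indices add up
    to [2k - t], which exceeds, equals or falls below [n-t-1] as [n] is [2k], [2k + 1] or larger. *)
Lemma paired_size_pure (n k t : nat) :
    (2 * k <= n)%N -> (0 < t < k)%N ->
  [/\ (paired_size n k t.+1 0 < 'C(n - t, k - t))%N = (n == 2 * k)%N &
      (paired_size n k t.+1 0 == 'C(n - t, k - t))%N = (n == (2 * k).+1)%N].
Proof.
move=> nk /andP[t0 tk]; rewrite /paired_size (@pencil_sizeS n k t) ?subn0 //; last by lia.
rewrite [('C(_, k - t) + _)%N]addnC ltn_add2l eqn_add2l.
have [n_eq|n_ne] := eqVneq n (2 * k)%N.
  have lt : ('C(n - t.+1, k) < 'C(n - t.+1, k - t))%N.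
    rewrite -bin_sub; last by lia.
    by apply: ltn_bin; lia.
  by rewrite lt ltn_eqF //; split => //; apply/esym/negbTE; lia.
have [n_eq'|n_ne'] := eqVneq n (2 * k).+1.
  have -> : 'C(n - t.+1, k) = 'C(n - t.+1, k - t).
    by rewrite -bin_sub; [congr 'C(_, _); lia|lia].
  by rewrite ltnn eqxx.
have gt : ('C(n - t.+1, k - t) < 'C(n - t.+1, k))%N by apply: ltn_bin; lia.
by rewrite gtn_eqF // ltnNge ltnW.
Qed.

Lemma paired_size_max (k j : nat) :
  (j <= k)%N -> paired_size (2 * k) k k j = 2%N.
Proof. by move=> jk; rewrite paired_size_half // subnn bin0. Qed.

Theorem theorem4 (R : realType) (V : finType) (n k t : nat)
    (I J : {set V}) (i j : nat)
    (hn : #|V| = n) (hk : (2 * k <= n)%N) (ht : (1 <= t <= k - 1)%N)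
    (hIJ : [disjoint I & J]) (hi : i = #|I|) (hj : j = #|J|)
    (hdeg : has_degree (paired R k I J) t) :
  [/\ fsize (paired R k I J) < 'C(n - t, k - t)%:R <->
        case_i n k t i j \/ case_ii n k t i j,
      case_i n k t i j ->
        fsize (paired R k I J) = (2 * 'C(2 * k - t - 1, k))%:R
        /\ (k = t.+1 ->
              [/\ fsize (paired R k I J) = 2,
                  i = t.+1 -> paired R k I J = paired R k I set0 &
                  j = t.+1 -> paired R k I J = paired R k set0 J]),
      case_ii n k t i j ->
        fsize (paired R k I J) = (2 * 'C(2 * k - i - j, k - i))%:R &
      fsize (paired R k I J) = 'C(n - t, k - t)%:R <->
        case_iii n k t i j \/ case_iv n k t i j].
Proof.
case: hdeg => p0 pt _.
have tk : (t < k)%N by card_lia.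
have t0 : (0 < t)%N by card_lia.
have := pencil_comb_paired hIJ; rewrite hn -hi -hj => /(_ R k t hk tk p0 pt) cases.
have [ik jk] : (i <= k)%N /\ (j <= k)%N by case: cases => [|[]|[]]; card_lia.
have sz : fsize (paired R k I J) = (paired_size n k i j)%:R.
  by rewrite fsize_paired ?hn -?hi -?hj.
have half (h : n = (2 * k)%N) : paired_size n k i j = (2 * 'C(2 * k - i - j, k - i))%N.
  by rewrite h paired_size_half.
have pencil_half : n = (2 * k)%N -> k = t.+1 -> 'C(n - t, k - t) = k.+1.
  by move=> -> kt; rewrite -[t]/(t.+1.-1) -kt pencil_size_half // kt.
(* Clearing the denominator compares twice the coefficient, the paired size, with the pencil size
   [k + 1]. *)
have rat_lt c : ((c%:R < k.+1%:R / 2 :> rat) = (2 * c < k.+1)%N).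
  by rewrite ltr_pdivlMr // -natrM ltr_nat mulnC.
have rat_eq c : (c%:R = k.+1%:R / 2 :> rat) <-> (2 * c = k.+1)%N.
  split => [e|<-]; last by rewrite natrM mulrC mulKf.
  by apply/eqP; rewrite -(eqr_nat rat) natrM e mulrC divfK.
have size_i : case_i n k t i j ->
    paired_size n k i j = (2 * 'C(2 * k - t - 1, k))%N.
  case=> _ n2k; rewrite n2k; case=> [[[ei ej]|[ei ej]]|[kt [l lt [[ei ej]|[ei ej]]]]].
  - rewrite paired_size_half // ei ej; congr muln.
    by rewrite -bin_sub; [congr 'C(_, _)|]; card_lia.
  - rewrite paired_size_half // ei ej; congr muln.
    by congr 'C(_, _); card_lia.
  - have -> : (2 * k - t - 1 = k)%N by card_lia.
    by rewrite ei -kt paired_size_max ?binn //; card_lia.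
  - have -> : (2 * k - t - 1 = k)%N by card_lia.
    by rewrite ej -kt paired_sizeC paired_size_max ?binn //; card_lia.
have pure := paired_size_pure hk (introT andP (conj t0 tk)).
have size_pure : same_pair i j t.+1 0 -> paired_size n k i j = paired_size n k t.+1 0.
  by case=> [[-> ->]|[-> ->]] //; exact: paired_sizeC.
split.
- rewrite sz ltr_nat; split => [lt|].
    case: cases => [small|[ijt ijk et]|[kij _ _ n2k [kt et]]].
    + by have := paired_size_small hk tk small; card_lia.
    + have [i0|i0] := posnP i.
        have sp : same_pair i j t.+1 0 by right; card_lia.
        by left; split => //; [apply/eqP; rewrite -(proj1 pure) -size_pure|left].
      have [j0|j0] := posnP j; last by have := paired_size_mixed hk tk ijt i0 j0; card_lia.
      have sp : same_pair i j t.+1 0 by left; card_lia.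
      by left; split => //; [apply/eqP; rewrite -(proj1 pure) -size_pure|left].
    (* As [k = t + 1], having [i = k] or [j = k] gives an alternative representation of [case_i],
       with the other cardinality as [l]. *)
    + have [ei|ei] := eqVneq i k.
        by left; split => //; right; split=> //; exists j; rewrite -?kt //; left.
      have [ej|ej] := eqVneq j k.
        by left; split => //; right; split=> //; exists i; rewrite -?kt //; right.
      have i_lt : (i < k)%N by rewrite ltn_neqAle ei.
      have j_lt : (j < k)%N by rewrite ltn_neqAle ej.
      by right; split => //; [card_lia|split => //; rewrite rat_lt -half // -pencil_half].
  case=> [c|[_ n2k kt _ [_]]]; last by rewrite rat_lt half // pencil_half.
  case: (c) => _ n2k [sp|[kt _]].
    by rewrite size_pure // (proj1 pure) n2k.
  rewrite size_i // pencil_half // (_ : (2 * k - t - 1 = k)%N) ?binn; card_lia.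
- move=> c; rewrite sz size_i //; split => // kt.
  have V2k : #|V| = (2 * k)%N by rewrite hn; case: c.
  split; first by rewrite (_ : (2 * k - t - 1 = k)%N) ?binn //; card_lia.
  + by move=> it; apply: paired_half; rewrite // -hi it kt.
  + move=> jt; rewrite paired_sym [RHS]paired_sym.
    by apply: paired_half; rewrite // -?hj ?jt ?kt // disjoint_sym.
- by case=> _ n2k _ _ _; rewrite sz half.
- rewrite sz; split => [/eqP|].
    rewrite eqr_nat => /eqP eq; case: cases => [small|[ijt ijk et]|[kij _ _ n2k [kt et]]].
    + by have := paired_size_small hk tk small; card_lia.
    + have [i0|i0] := posnP i.
        have sp : same_pair i j t.+1 0 by right; card_lia.
        by left; split => //; [card_lia|apply/eqP; rewrite -(proj2 pure) -size_pure // eq].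
      have [j0|j0] := posnP j; last by have := paired_size_mixed hk tk ijt i0 j0; card_lia.
      have sp : same_pair i j t.+1 0 by left; card_lia.
      by left; split => //; [card_lia|apply/eqP; rewrite -(proj2 pure) -size_pure // eq].
    (* [i = k] would give size 2, but the pencil size is [k + 1 >= 3]. *)
    + have i_lt : (i < k)%N.
        rewrite ltn_neqAle ik andbT; apply/eqP => ei; move: eq; rewrite pencil_half // n2k ei paired_size_max //; card_lia.
      have j_lt : (j < k)%N.
        rewrite ltn_neqAle jk andbT; apply/eqP => ej; move: eq.
        by rewrite pencil_half // n2k ej paired_sizeC paired_size_max //; card_lia.
      right; split => //; [card_lia|split; first exact: ltnW].
      by apply/rat_eq; rewrite -half // -pencil_half.
  case=> [[_ _ n2k sp]|[_ n2k kt _ [_ /rat_eq e]]].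
    by apply/eqP; rewrite eqr_nat size_pure // (proj2 pure) n2k.
  by rewrite half // e pencil_half.
Qed.
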